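(* For all $m,n\geq 3$, $\operatorname{im}(C_m\times C_n)=5$.
   Context: All graphs are finite and simple. $C_k$ is the cycle on $k$ vertices. A graph $G$ has a $G'$-immersion if there is an injective map $\phi:V(G')\to V(G)$ such that for every edge $uv\in E(G')$ there is a path in $G$ joining $\phi(u)$ and $\phi(v)$, and these paths are pairwise edge-disjoint. The immersion number $\operatorname{im}(G)$ is the largest $t$ such that $G$ has a $K_t$-immersion. The direct product $G\times H$ has vertex set $V(G)\times V(H)$, with $(g,h)$ adjacent to $(g',h')$ iff $gg'\in E(G)$ and $hh'\in E(H)$. *)

(* Defs.v *)
From mathcomp Require Import all_boot.
From mathcomp Require Import boolp.

Set Implicit Arguments.
Unset Strict Implicit.
Unset Printing Implicit Defensive.

Record sgraph := SGraph {
  vertex :> finType;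
  adj : rel vertex;
  adj_sym : symmetric adj;
  adj_irrefl : irreflexive adj }.

Definition edges (G : sgraph) : {set {set G}} :=
  [set [set x; y] | x in G, y in G & adj x y].

Definition complete_rel (t : nat) : rel 'I_t := [rel i j | i != j].

Lemma complete_rel_sym t : symmetric (@complete_rel t).
Proof. by move=> i j; rewrite /complete_rel /= eq_sym. Qed.

Lemma complete_rel_irrefl t : irreflexive (@complete_rel t).
Proof. by move=> i; rewrite /complete_rel /= eqxx. Qed.

Definition complete (t : nat) : sgraph :=
  SGraph (@complete_rel_sym t) (@complete_rel_irrefl t).

(* The conjunct [i != j] only matters for [k = 1], where it removes the loop;
   this is the usual cycle on k vertices when [3 <= k]. *)
Definition cycle_rel (k : nat) : rel 'I_k :=
  [rel i j | (i != j) && ((j == ordS i) || (i == ordS j))].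

Lemma cycle_rel_sym k : symmetric (@cycle_rel k).
Proof. by move=> i j; rewrite /cycle_rel /= eq_sym orbC. Qed.

Lemma cycle_rel_irrefl k : irreflexive (@cycle_rel k).
Proof. by move=> i; rewrite /cycle_rel /= eqxx. Qed.

Definition cycle_graph (k : nat) : sgraph :=
  SGraph (@cycle_rel_sym k) (@cycle_rel_irrefl k).

Definition direct_rel (G H : sgraph) : rel (G * H) :=
  [rel p q | adj p.1 q.1 && adj p.2 q.2].

Lemma direct_rel_sym G H : symmetric (@direct_rel G H).
Proof. by move=> p q; rewrite /direct_rel /= adj_sym (adj_sym p.2). Qed.

Lemma direct_rel_irrefl G H : irreflexive (@direct_rel G H).
Proof. by move=> p; rewrite /direct_rel /= adj_irrefl. Qed.

Definition direct_product (G H : sgraph) : sgraph :=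
  SGraph (@direct_rel_sym G H) (@direct_rel_irrefl G H).

(* A path is given by its sequence of (distinct) vertices, traversed from
   either end. *)
Definition joins (G : sgraph) (s : seq G) (x y : G) : bool :=
  if s is x0 :: p then
    [&& path (@adj G) x0 p, uniq s & [set x0; last x0 p] == [set x; y]]
  else false.

Definition path_edges (G : sgraph) (s : seq G) : {set {set G}} :=
  [set [set e.1; e.2] | e in zip s (behead s)].

(* [P] is only constrained on the edges of [G']: one path per edge. *)
Definition has_immersion (G' G : sgraph) : Prop :=
  exists (phi : G' -> G) (P : {set G'} -> seq G),
    [/\ injective phi,
        forall u v : G', adj u v -> joins (P [set u; v]) (phi u) (phi v)
      & forall e f : {set G'}, e \in edges G' -> f \in edges G' -> e != f ->
          [disjoint path_edges (P e) & path_edges (P f)]].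

(* An immersion of K_t is injective on vertices, so t ranges over 0..#|G|;
   see [immersion_numberP]. *)
Definition immersion_number (G : sgraph) : nat :=
  \max_(t < #|G|.+1 | `[< has_immersion (complete t) G >]) t.

Lemma immersion_complete0 (G : sgraph) : has_immersion (complete 0) G.
Proof.
have no (i : 'I_0) : False by case: i.
exists (fun i => False_rect G (no i)), (fun=> [::]).
by split=> [i|i|e f /imset2P[i]]; case: (no i).
Qed.

Lemma immersion_complete_card t (G : sgraph) :
  has_immersion (complete t) G -> t <= #|G|.
Proof. by case=> phi [P [/leq_card]]; rewrite card_ord. Qed.

Lemma immersion_numberP (G : sgraph) (t : nat) :
  immersion_number G = t <->
  has_immersion (complete t) G /\
  (forall s, has_immersion (complete s) G -> s <= t).
Proof.
have ub s : has_immersion (complete s) G -> s <= immersion_number G.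
  move=> Gs; have lt_s : s < #|G|.+1 := immersion_complete_card Gs.
  exact: (@leq_bigmax_cond _ _ (fun i : 'I_#|G|.+1 => val i)
           (Ordinal lt_s) (asboolT Gs)).
have im : has_immersion (complete (immersion_number G)) G.
  have /(eq_bigmax_cond (fun i : 'I_#|G|.+1 => val i)) :
      0 < #|[pred i : 'I_#|G|.+1 | `[< has_immersion (complete i) G >]]|.
    by apply/card_gt0P; exists ord0; apply/asboolP/immersion_complete0.
  by case=> i /asboolP Gi /= eq_i; rewrite /immersion_number [X in complete X]eq_i.
split=> [<- // | [Gt max_t]].
by apply/eqP; rewrite eqn_leq max_t // ub.
Qed.

(* Main.v *)
Require Import Defs.
From mathcomp Require Import all_boot.
From mathcomp Require Import boolp zmodp zify.

(** Upper bound: the t - 1 edge-disjoint paths leaving a branch vertex of a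
    K_t-immersion use distinct edges at that vertex, and the product of two
    cycles is 4-regular.

    Lower bound: C_(m+2) folds onto C_m by wrapping the path m-1, m, m+1, 0
    around the edge {m-1, 0}.  Unfolding replaces an edge (m-1,h)(0,h') of
    C_m x H by the path (m-1,h), (m,h'), (m+1,h), (0,h'), and distinct edges get
    edge-disjoint paths.  So C_m x H immerses in C_(m+2) x H, and as immersions
    compose, only the products 3x3, 3x4 and 4x4 remain; there a K_5-immersion is
    exhibited. *)

Set Implicit Arguments.
Unset Strict Implicit.
Unset Printing Implicit Defensive.

(** * Immersions as edge colourings *)

(* An immersion of [G'] amounts to colouring the edges of [G] by edges of [G']
   so that [phi u] and [phi v] are connected within the colour [uv].  In this
   form immersions compose by composing the colourings. *)
Definition colour_immersion (G' G : sgraph) : Prop :=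
  exists (phi : G' -> G) (c : {set G} -> {set G'}),
    injective phi /\
    forall u v : G', adj u v ->
      connect [rel x y | adj x y && (c [set x; y] == [set u; v])] (phi u) (phi v).

Lemma eq_set2 (T : finType) (a b x y : T) :
  [set a; b] = [set x; y] -> (a = x /\ b = y) \/ (a = y /\ b = x).
Proof.
move=> eqs.
have := set21 a b; rewrite eqs => /set2P[] ea; have := set22 a b;
  rewrite eqs => /set2P[] eb; subst; auto.
- by have := set22 x y; rewrite -eqs => /set2P[] ->; auto.
- by have := set21 x y; rewrite -eqs => /set2P[] ->; auto.
Qed.

Lemma mem_zip_behead_path (T : eqType) (r : rel T) x p e :
  path r x p -> e \in zip (x :: p) p -> r e.1 e.2.
Proof.
elim: p x => //= y p IHp x /andP[rxy ryp]; rewrite inE => /predU1P[-> //|].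
exact: IHp.
Qed.

(** A walk inside the colour class of [e], once shortened to a path, still has all its edges
    coloured [e]. An edge common to the paths of [e] and [f] thus forces [e = f]. *)
Lemma colour_immersionW (G' G : sgraph) :
  colour_immersion G' G -> has_immersion G' G.
Proof.
move=> [phi [c [phi_inj conn]]].
(* One path is chosen per unordered edge, so it must serve both orderings of the endpoints. *)
have /choice[P HP] : forall e : {set G'}, exists s : seq G, e \in edges G' ->
    (forall u v, e = [set u; v] -> joins s (phi u) (phi v)) /\
    (forall f, f \in path_edges s -> c f = e).
  move=> e; case: (boolP (e \in edges G')) => [|_]; last by exists [::].
  case/imset2P => u v _; rewrite inE => /andP[_ uv] ->.
  have /connectP[p0 rp0 lastp0] := conn u v uv.
  case/shortenP: rp0 lastp0 => p rp uniqp _ lastp.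
  exists (phi u :: p) => _; split.
    move=> u' v' euv; apply/and3P; split=> //.
      by apply: sub_path rp => x y /andP[].
    rewrite -lastp; apply/eqP.
    by case: (eq_set2 euv) => [[-> ->] // | [-> ->]]; rewrite setUC.
  by move=> f /imsetP[xy /(mem_zip_behead_path rp) /= /andP[_ /eqP cxy] ->].
exists phi, P; split=> // [u v uv | e f eG fG neq_ef].
  have eG : [set u; v] \in edges G' by apply/imset2P; exists u v; rewrite ?inE.
  by have [+ _] := HP _ eG; apply.
apply/pred0P => x /=; apply/negP => /andP[xe xf]; case/eqP: neq_ef.
by have [_ /(_ _ xe) <-] := HP _ eG; have [_ /(_ _ xf)] := HP _ fG.
Qed.

Lemma colour_immersion_trans (G1 G2 G3 : sgraph) :
  colour_immersion G1 G2 -> colour_immersion G2 G3 -> colour_immersion G1 G3.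
Proof.
move=> [phi [c [phi_inj conn]]] [psi [d [psi_inj dconn]]].
exists (psi \o phi), (c \o d); split=> [|u v uv]; first exact: inj_comp.
have /connectP[p + /= ->] := conn u v uv.
elim: p (phi u) => //= y p IHp x /andP[/andP[xy /eqP cxy] yp].
apply: connect_trans (IHp y yp).
apply: connect_sub (dconn x y xy) => a b /= /andP[ab /eqP dab].
by apply: connect1; rewrite /= ab dab cxy eqxx.
Qed.

Lemma swap_colour_immersion (G H : sgraph) :
  colour_immersion (direct_product G H) (direct_product H G).
Proof.
pose sw (x : direct_product H G) : direct_product G H := (x.2, x.1).
exists (fun u => (u.2, u.1)), (fun s : {set direct_product H G} => sw @: s); split.
  by move=> [a b] [a' b'] [-> ->].
move=> [u h] [v k] uv; apply: connect1.
by rewrite /= imsetU1 imset_set1 /sw /= eqxx andbT; move: uv; rewrite /= /direct_rel /= andbC.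
Qed.

(** * Lengthening a cycle by two *)

(** Edges are coloured by their image under [pi] on the first coordinate. The detour through
    [(b, k)] and [(a, h)] runs back and forth over the single edge between [(u, h)] and [(v, k)],
    and its odd length makes the second coordinate end at [k]. *)
Lemma fold_colour_immersion (G G2 H : sgraph) (pi : G2 -> G) (phi : G -> G2) :
    cancel phi pi ->
    (forall u v, adj u v -> adj (phi u) (phi v) \/
       exists a b, [/\ adj (phi u) b, adj b a, adj a (phi v), pi a = u & pi b = v]) ->
  colour_immersion (direct_product G H) (direct_product G2 H).
Proof.
move=> phiK unfold.
pose piH (x : direct_product G2 H) : direct_product G H := (pi x.1, x.2).
exists (fun u => (phi u.1, u.2)), (fun s : {set direct_product G2 H} => piH @: s); split.
  by move=> [a h] [b k] [/(can_inj phiK) -> ->].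
move=> [u h] [v k] /= /andP[/= uv hk].
have [uv2 | [a [b [ub ba av pia pib]]]] := unfold u v uv.
  by apply: connect1; rewrite /= imsetU1 imset_set1 /piH /= !phiK eqxx /direct_rel /= uv2 hk.
have kh : adj k h by rewrite adj_sym.
apply: (@connect_trans _ _ (b, k)).
  by apply: connect1; rewrite /= imsetU1 imset_set1 /piH /= phiK pib eqxx /direct_rel /= ub hk.
apply: (@connect_trans _ _ (a, h)).
  by apply: connect1; rewrite /= imsetU1 imset_set1 /piH /= setUC pia pib eqxx /direct_rel /= ba kh.
by apply: connect1; rewrite /= imsetU1 imset_set1 /piH /= phiK pia eqxx /direct_rel /= av hk.
Qed.

Lemma cycle_colour_immersionS2 (H : sgraph) m : 0 < m ->
  colour_immersion (direct_product (cycle_graph m) H)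
                   (direct_product (cycle_graph m.+2) H).
Proof.
case: m => // k _.
(* With [m = k + 1], the two new vertices [k + 1] and [k + 2] fold onto [0] and [k]. *)
pose pi (x : 'I_k.+3) : 'I_k.+1 :=
  inord (if x < k.+1 then x : nat else if x == k.+1 :> nat then 0 else k).
pose phi (u : 'I_k.+1) : 'I_k.+3 := inord u.
have phiE u : phi u = u :> nat by rewrite inordK //; have := ltn_ord u; lia.
have phiK : cancel phi pi.
  by move=> u; apply: val_inj; rewrite /pi phiE ltn_ord inord_val.
pose good u v := adj (phi u : cycle_graph _) (phi v) \/
   exists a b : cycle_graph k.+3,
     [/\ adj (phi u : cycle_graph _) b, adj b a, adj a (phi v : cycle_graph _), pi a = u & pi b = v].
have good_sym u v : good u v -> good v u.
  case=> [uv | [a [b [ub ba av pia pib]]]]; first by left; rewrite adj_sym.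
  by right; exists b, a; split; rewrite // adj_sym.
have goodS u : u != ordS u -> good u (ordS u).
  rewrite -val_eqE /= => neq; have := ltn_ord u; rewrite ltnS leq_eqVlt.
  case/predU1P => [uk | ltuk].
    (* The closing edge from [k] to [0] becomes [k, k + 1, k + 2, 0]. The case [k = 0] is excluded
       since there [ordS u = u]. *)
    have k_gt0 : 0 < k by move: neq; rewrite uk modnn; lia.
    right; exists (inord k.+2), (inord k.+1).
    split; rewrite /= /cycle_rel /= -?val_eqE /= ?phiE ?uk ?modnn ?inordK ?modnn //=.
    - by rewrite (@modn_small k.+1) // eqxx; lia.
    - by rewrite (@modn_small k.+2) // eqxx; lia.
    - by rewrite uk modnn.
    - apply: val_inj; rewrite /pi (@inordK k.+2) // ltnNge leqnSn /=.
      by rewrite (gtn_eqF (ltnSn _)) inordK.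
    - apply: val_inj; rewrite /pi (@inordK k.+2) // ltnn eqxx /=.
      by rewrite inordK // uk modnn.
  left; rewrite /= /cycle_rel /= -!val_eqE /= !phiE /=.
  by rewrite !(@modn_small u.+1) ?eqxx //=; lia.
apply: (@fold_colour_immersion (cycle_graph _) (cycle_graph _) _ pi phi) => // u v /= /andP[neq /orP[]/eqP e]; subst.
  exact: goodS.
by apply/good_sym/goodS; rewrite eq_sym.
Qed.

Lemma cycle_colour_immersionD (H : sgraph) m k : 0 < m ->
  colour_immersion (direct_product (cycle_graph m) H)
                   (direct_product (cycle_graph (m + k.*2)) H).
Proof.
move=> m_gt0; elim: k => [|k IHk].
  rewrite addn0; exists id, id; split=> // u v uv.
  by apply: connect1; rewrite /= eqxx andbT.
apply: colour_immersion_trans IHk _; rewrite doubleS !addnS.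
by apply: cycle_colour_immersionS2; rewrite addn_gt0 m_gt0.
Qed.

(** * The three small products *)

Section Table.

Variables (t : nat) (G : sgraph) (x0 : G) (B : seq G).
(* An entry [((i, j), s)] is a path [s] from [B_i] to [B_j]. *)
Variable T : seq (nat * nat * seq G).

Definition uses (x y : G) (s : seq G) : bool :=
  ((x, y) \in zip s (behead s)) || ((y, x) \in zip s (behead s)).

(** An edge on no path gets the default [(0, 0)], which is not an edge of K_t. *)
Definition table_colour (x y : G) : nat * nat :=
  (nth ((0, 0), [::]) T (find (fun e => uses x y e.2) T)).1.

(* Requiring each path to lie in its own colour class of [table_colour], which
   picks the first path using an edge, enforces edge-disjointness. *)
Definition good_entry (e : nat * nat * seq G) : bool :=
  if e.2 is x :: p then
    [&& x == nth x0 B e.1.1, last x p == nth x0 B e.1.2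
      & path [rel x y | adj x y && (table_colour x y == e.1)] x p]
  else false.

Definition good_table : bool :=
  [&& size B == t, uniq B, all good_entry T
    & all (fun ij => (ij.1 < ij.2) ==> (ij \in unzip1 T))
          [seq (i, j) | i <- iota 0 t, j <- iota 0 t]].

Lemma table_colour_sym x y : table_colour x y = table_colour y x.
Proof.
by rewrite /table_colour (@eq_find _ _ (fun e => uses y x e.2)) // => e; exact: orbC.
Qed.

Lemma good_table_immersion : good_table -> colour_immersion (complete t) G.
Proof.
case/and4P => /eqP sizeB uniqB /allP goodT /allP allT.
pose K (ij : nat * nat) := [set u : complete t | (val u == ij.1) || (val u == ij.2)].
(* [table_colour] reads ordered pairs, so an ordering of [s] is picked; by symmetry the choice does
   not matter. *)
pose c (s : {set G}) : {set complete t} :=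
  if [pick p : G * G | s == [set p.1; p.2]] is Some p
  then K (table_colour p.1 p.2) else set0.
have cE x y : c [set x; y] = K (table_colour x y).
  rewrite /c; case: pickP => [[a b] /eqP /eq_set2[[-> ->] //|[-> ->]]|/(_ (x, y))] /=.
    by rewrite table_colour_sym.
  by rewrite eqxx.
pose phi (i : complete t) : G := nth x0 B (val i).
exists phi, c; split=> [i j eqij|].
  by apply/val_inj/eqP; rewrite -(nth_uniq x0 _ _ uniqB) ?sizeB ?ltn_ord //; apply/eqP.
have conn (u v : complete t) : val u < val v ->
    connect [rel x y | adj x y && (c [set x; y] == [set u; v])] (phi u) (phi v).
  move=> ltuv.
  have /allT /= : (val u, val v) \in [seq (i, j) | i <- iota 0 t, j <- iota 0 t].
    by apply: allpairs_f; rewrite mem_iota /= add0n ltn_ord.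
  rewrite ltuv => /mapP[[ij s] /goodT good /= eq_uv]; move: good; subst ij.
  rewrite /good_entry /=; case: s => // x p /and3P[/eqP-> /eqP lastp pathp].
  apply/connectP; exists p => //; apply: sub_path pathp => a b /= /andP[-> /eqP cab].
  by rewrite cE cab; apply/eqP/setP => w; rewrite !inE -!val_eqE.
move=> u v; rewrite /= /complete_rel /= -val_eqE neq_ltn => /orP[/conn // | ltvu].
rewrite [[set u; v]]setUC sym_connect_sym; first exact: conn.
by move=> x y; rewrite /= adj_sym setUC.
Qed.

End Table.

(** The parameters are one less than the cycle lengths, as [inZp] needs a nonzero modulus. *)
Definition torus_vertex m n (x : nat * nat) :
    direct_product (cycle_graph m.+1) (cycle_graph n.+1) :=
  (inZp x.1, inZp x.2).

Definition torus_table m n (B : seq (nat * nat)) (T : seq (nat * nat * seq (nat * nat))) :=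
  good_table 5 (torus_vertex m n (0, 0)) (map (torus_vertex m n) B)
    [seq (e.1, map (torus_vertex m n) e.2) | e <- T].

Lemma torus33_immersion :
  colour_immersion (complete 5) (direct_product (cycle_graph 3) (cycle_graph 3)).
Proof.
suff: torus_table 2 2 [:: (0, 0); (1, 1); (2, 2); (2, 0); (0, 2)]
  [:: ((0, 1), [:: (0, 0); (1, 1)]);
      ((0, 2), [:: (0, 0); (2, 2)]);
      ((0, 3), [:: (0, 0); (1, 2); (2, 0)]);
      ((0, 4), [:: (0, 0); (2, 1); (0, 2)]);
      ((1, 2), [:: (1, 1); (2, 2)]);
      ((1, 3), [:: (1, 1); (2, 0)]);
      ((1, 4), [:: (1, 1); (0, 2)]);
      ((2, 3), [:: (2, 2); (0, 1); (2, 0)]);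
      ((2, 4), [:: (2, 2); (1, 0); (0, 2)]);
      ((3, 4), [:: (2, 0); (0, 2)])].
  exact: good_table_immersion.
by vm_compute.
Qed.

Lemma torus34_immersion :
  colour_immersion (complete 5) (direct_product (cycle_graph 3) (cycle_graph 4)).
Proof.
suff: torus_table 2 3 [:: (0, 0); (2, 0); (1, 3); (1, 2); (0, 1)]
  [:: ((0, 1), [:: (0, 0); (1, 1); (2, 0)]);
      ((0, 2), [:: (0, 0); (1, 3)]);
      ((0, 3), [:: (0, 0); (2, 1); (1, 2)]);
      ((0, 4), [:: (0, 0); (2, 3); (1, 0); (0, 1)]);
      ((1, 2), [:: (2, 0); (1, 3)]);
      ((1, 3), [:: (2, 0); (0, 3); (1, 2)]);
      ((1, 4), [:: (2, 0); (0, 1)]);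
      ((2, 3), [:: (1, 3); (0, 2); (2, 3); (1, 2)]);
      ((2, 4), [:: (1, 3); (2, 2); (0, 1)]);
      ((3, 4), [:: (1, 2); (0, 1)])].
  exact: good_table_immersion.
by vm_compute.
Qed.

Lemma torus44_immersion :
  colour_immersion (complete 5) (direct_product (cycle_graph 4) (cycle_graph 4)).
Proof.
(* C_4 x C_4 is disconnected. All five branch vertices lie in the component of even coordinate sum,
   a K_{4,4}, and the ten paths use all of its 16 edges. *)
suff: torus_table 3 3 [:: (0, 0); (0, 2); (2, 0); (3, 1); (3, 3)]
  [:: ((0, 1), [:: (0, 0); (1, 3); (2, 2); (1, 1); (0, 2)]);
      ((0, 2), [:: (0, 0); (1, 1); (2, 0)]);
      ((0, 3), [:: (0, 0); (3, 1)]);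
      ((0, 4), [:: (0, 0); (3, 3)]);
      ((1, 2), [:: (0, 2); (1, 3); (2, 0)]);
      ((1, 3), [:: (0, 2); (3, 1)]);
      ((1, 4), [:: (0, 2); (3, 3)]);
      ((2, 3), [:: (2, 0); (3, 1)]);
      ((2, 4), [:: (2, 0); (3, 3)]);
      ((3, 4), [:: (3, 1); (2, 2); (3, 3)])].
  exact: good_table_immersion.
by vm_compute.
Qed.

Lemma torus_small_immersion a b : a \in [:: 3; 4] -> b \in [:: 3; 4] ->
  colour_immersion (complete 5) (direct_product (cycle_graph a) (cycle_graph b)).
Proof.
rewrite !inE => /orP[]/eqP-> /orP[]/eqP->.
- exact: torus33_immersion.
- exact: torus34_immersion.
- exact: colour_immersion_trans torus34_immersion (swap_colour_immersion _ _).
- exact: torus44_immersion.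
Qed.

Lemma geq3_double m : 2 < m -> exists a k, [/\ a \in [:: 3; 4], 0 < a & m = a + k.*2].
Proof.
(* The base is 3 for odd [m] and 4 for even [m]; rounding down makes [(m - 3)./2] correct in both
   cases. *)
move=> m_ge3; exists (3 + ~~ odd m), ((m - 3)./2).
by split; [case: (odd m) | | case: (boolP (odd m)); lia].
Qed.

Lemma torus_immersion m n : 2 < m -> 2 < n ->
  colour_immersion (complete 5) (direct_product (cycle_graph m) (cycle_graph n)).
Proof.
move=> /geq3_double[a [k [a34 a_gt0 ->]]] /geq3_double[b [l [b34 b_gt0 ->]]].
(* Only the first factor can be lengthened, so the factors are swapped between the two
   lengthenings. *)
apply: colour_immersion_trans (cycle_colour_immersionD _ k a_gt0).
apply: colour_immersion_trans (swap_colour_immersion _ _).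
apply: colour_immersion_trans (cycle_colour_immersionD _ l b_gt0).
exact: torus_small_immersion.
Qed.

(** * The degree bound *)

Lemma path_edge_at (G : sgraph) (x z : G) p :
    path (@adj G) z p -> 0 < size p -> x \in z :: p ->
  exists y, adj x y && ([set x; y] \in path_edges (z :: p)).
Proof.
have edge (a b : G) s : (a, b) \in zip s (behead s) -> [set a; b] \in path_edges s.
  by move=> ab; apply/imsetP; exists (a, b).
elim: p z => //= w p IHp z /andP[zw wp] _; rewrite inE => /predU1P[->|xwp].
  by exists w; rewrite zw; apply: edge; rewrite /= mem_head.
case: p IHp wp xwp => [_ _|w' p IHp wp xwp].
  (* The last vertex has no successor; its edge is the one back to [z]. *)
  rewrite mem_seq1 => /eqP->; exists z.
  by rewrite adj_sym zw setUC; apply: edge; rewrite /= mem_head.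
have [y /andP[xy]] := IHp w wp isT xwp.
case/imsetP => e eP eE; exists y; rewrite xy eE /=.
by apply/imsetP; exists e => //; rewrite inE eP orbT.
Qed.

Lemma immersion_complete_degree (G : sgraph) d s :
    (forall x : G, #|[pred y | adj x y]| <= d) ->
  has_immersion (complete s) G -> s <= d.+1.
Proof.
move=> deg; case: s => // s [phi [P [phi_inj joinsP disjP]]].
pose x := phi ord0; pose e (j : 'I_s) : {set complete s.+1} := [set ord0; lift ord0 j].
have e_edge j : e j \in edges (complete s.+1).
  by apply/imset2P; exists (ord0 : complete s.+1) (lift ord0 j : complete s.+1); rewrite ?inE /=.
have /choice[y yP] : forall j : 'I_s, exists y,
    adj x y && ([set x; y] \in path_edges (P (e j))).
  move=> j; have := joinsP ord0 (lift ord0 j) (neq_lift _ _).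
  rewrite /joins -/(e j); case: (P (e j)) => // z p /and3P[zp _ /eqP ends].
  apply: path_edge_at zp _ _.
    (* A one-vertex path would identify the images of two distinct branch vertices. *)
    case: p ends => // /eq_set2 /= [[-> /phi_inj]|[-> /phi_inj]] //.
  have : x \in [set z; last z p] by rewrite ends set21.
  by case/set2P => ->; rewrite ?mem_head ?mem_last.
(* If [y i = y j] with [i != j], the same edge at [x] would lie on two disjoint paths. *)
have y_inj : injective y.
  move=> i j eqy; apply/eqP/negP => /negP neq_ij.
  have /disjP : e i != e j.
    apply: contra neq_ij => /eqP /eq_set2[[_ /lift_inj -> //]|[]].
    by move/eqP; rewrite (negPf (neq_lift _ _)).
  move=> /(_ (e_edge i) (e_edge j)) /pred0P /(_ [set x; y i]) /=.
  by case/andP: (yP i) => _ ->; rewrite eqy; case/andP: (yP j) => _ ->.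
rewrite ltnS; apply: leq_trans (deg x); rewrite -[s]card_ord -(card_codom y_inj).
by apply/subset_leq_card/subsetP => _ /codomP[j ->]; rewrite inE; case/andP: (yP j).
Qed.

Lemma cycle_degree k (x : cycle_graph k) : #|[pred y | adj x y]| <= 2.
Proof.
apply: leq_trans (_ : #|[set ordS x; ord_pred x]| <= 2); last by rewrite cards2; case: eqP.
apply/subset_leq_card/subsetP => y /andP[_ /orP[]/eqP->]; first exact: set21.
by rewrite ordSK set22.
Qed.

Lemma direct_product_degree (G H : sgraph) (x : direct_product G H) :
  #|[pred y | adj x y]| = #|[pred y | adj x.1 y]| * #|[pred y | adj x.2 y]|.
Proof. by rewrite -cardX; apply: eq_card => y. Qed.

Theorem theorem26 (m n : nat) (hm : 3 <= m) (hn : 3 <= n) :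
  immersion_number (direct_product (cycle_graph m) (cycle_graph n)) = 5.
Proof.
apply/immersion_numberP; split; first exact/colour_immersionW/torus_immersion.
move=> s; apply: (@immersion_complete_degree _ 4) => x.
by rewrite direct_product_degree (leq_mul (cycle_degree _) (cycle_degree _)).
Qed.
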